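(* Let $H$ be a simple graph of even order $n\ge 4$ with $m$ edges and no fixed-point-free involutory automorphism. Let $M>m$ be real, let $N=n+1$, let $W_M(H)$ be the weighted cone over $H$ with cone weight $M$, and set $T=\frac{4Mn^2-4m}{N}$ and $Q=\sqrt{2nM^2+2m}$. Then $$\Phi(W_M(H))\ge T+\frac{N}{16M}\quad\text{and}\quad\operatorname{FR}_{\min}(W_M(H))\ge\frac{T}{Q}+\frac{N}{16MQ}.$$
   Context: A nonnegative weighted graph is a pair $(V,w)$ with $V$ a finite set and $w:\binom{V}{2}\to[0,\infty)$; its weighted adjacency matrix $W=(w_{uv})$ is symmetric with zero diagonal. A simple graph is the case where all weights lie in $\{0,1\}$. For a weighted adjacency matrix $W$ of order $N=|V|$, a labeling is a bijection $\pi:\mathbb{Z}_N\to V$, and $W_\pi$ is the matrix indexed by $\mathbb{Z}_N$ with entries $W_\pi(x,y)=w_{\pi(x)\pi(y)}$. Let $F_N(r,x)=\frac{1}{\sqrt N}e^{-2\pi i rx/N}$ for $r,x\in\mathbb{Z}_N$. For a matrix $C$, $\|C\|_1=\sum_{r,v}|C_{rv}|$ and $\|C\|_2=(\sum_{r,v}|C_{rv}|^2)^{1/2}$. Define $\Phi(W)=\min_\pi\|F_NW_\pi F_N\|_1$, the minimum over all labelings, and, for $W\neq 0$, $\operatorname{FR}_{\min}(W)=\Phi(W)/\|W\|_2$. The weighted cone $W_M(H)$ is the weighted graph of order $N=n+1$ obtained from $H$ (edges of weight $1$) by adjoining one new vertex $c$ and giving every edge from $c$ to a vertex of $H$ weight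 $M$; the same symbol denotes its weighted adjacency matrix. A fixed-point-free involutory automorphism of $H$ is a graph automorphism $\tau$ with $\tau^2=\mathrm{id}$ and $\tau(v)\ne v$ for every vertex $v$. *)

(* Defs.v *)
From HB Require Import structures.
From mathcomp Require Import all_boot all_order all_algebra.
From mathcomp Require Import complex.
From mathcomp Require Import boolp reals trigo.

Set Implicit Arguments.
Unset Strict Implicit.
Unset Printing Implicit Defensive.

Import Order.TTheory GRing.Theory Num.Theory.

Local Open Scope ring_scope.
Local Open Scope complex_scope.

Section Matrices.
Variable R : realType.

(* e^{it} *)
Definition expi (t : R) : R[i] := cos t +i* sin t.

(* Z_N is represented by 'I_N: the entry only depends on r and x modulo N. *)
Definition fourier_mx (N : nat) : 'M[R[i]]_N :=
  \matrix_(r, x) ((Num.sqrt N%:R)^-1%:C * expi (- (2 * pi * r%:R * x%:R / N%:R))).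

Definition norm1 (I J : finType) (C : I -> J -> R[i]) : R :=
  \sum_r \sum_v Normc.normc (C r v).

Definition norm2 (I J : finType) (C : I -> J -> R[i]) : R :=
  Num.sqrt (\sum_r \sum_v Normc.normc (C r v) ^+ 2).

End Matrices.

Section Labelings.
Variables (R : realType) (V : finType).
Implicit Types (W : V -> V -> R) (p : {ffun 'I_#|V| -> V}).

Definition weighted_adjacency W : Prop :=
  [/\ forall u v, 0 <= W u v, forall u v, W u v = W v u & forall u, W u u = 0].

Definition labeling p : bool := `[< bijective p >].

Definition relabel W p : 'M[R]_#|V| := \matrix_(x, y) W (p x) (p y).

Definition fourier_norm1 W p : R :=
  norm1 (fourier_mx R #|V| *m map_mx (real_complex R) (relabel W p)
           *m fourier_mx R #|V|).

Definition labeling0 : {ffun 'I_#|V| -> V} := [ffun i => enum_val i].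

(* The default value of the iterated minimum is attained at a labeling, so it
   does not affect the minimum: see [Phi_le] and [Phi_attained]. *)
Definition Phi W : R :=
  \big[Num.min/fourier_norm1 W labeling0]_(p | labeling p) fourier_norm1 W p.

Definition FRmin W : R := Phi W / norm2 (fun u v => (W u v)%:C).

Lemma labeling0P : labeling labeling0.
Proof.
apply/asboolP; exists (@enum_rank V) => x; rewrite ffunE.
  exact: enum_valK.
exact: enum_rankK.
Qed.

Lemma Phi_le W p : labeling p -> Phi W <= fourier_norm1 W p.
Proof. by move=> lp; rewrite /Phi (bigD1 p) //= ge_min lexx. Qed.

Lemma Phi_attained W : exists2 p, labeling p & Phi W = fourier_norm1 W p.
Proof.
rewrite /Phi; elim/big_ind: _ => [|x y [p lp ->] [q lq ->]|p lp].
- by exists labeling0 => //; exact: labeling0P.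
- by case: leP => _; [exists p|exists q].
- by exists p.
Qed.

End Labelings.

Section SimpleGraphs.
Variables (V : finType) (e : rel V).

Definition simple_graph : Prop := symmetric e /\ irreflexive e.

Definition edges : {set {set V}} := [set [set uv.1; uv.2] | uv : V * V & e uv.1 uv.2].

Definition automorphism (tau : V -> V) : Prop :=
  bijective tau /\ forall u v, e (tau u) (tau v) = e u v.

Definition fpf_involutory_automorphism (tau : V -> V) : Prop :=
  [/\ automorphism tau, involutive tau & forall v, tau v != v].

(* The apex of the cone is [None]. *)
Definition cone (R : realType) (M : R) (x y : option V) : R :=
  match x, y with
  | Some u, Some v => (e u v)%:R
  | Some _, None | None, Some _ => M
  | None, None => 0
  end.

Lemma cone_weighted_adjacency (R : realType) (M : R) :
  simple_graph -> 0 <= M -> weighted_adjacency (cone M).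
Proof.
case=> sym irr M0; split; last by case=> [u|] //=; rewrite irr.
- by move=> [u|] [v|] //=; exact: ler0n.
- by move=> [u|] [v|] //=; rewrite sym.
Qed.

End SimpleGraphs.

(* Main.v *)
(* Move the apex of the cone to 0 and write (up to unimodular factors)
   N F W F (r, s) = G(r, s) = sum_(u, v) W(u, v) chi_r(u) chi_s(v), with chi_r
   the characters of Z_N.  Bounding |G| below by Re G when r = 0 or s = 0 and
   by - Re G otherwise, and summing, gives exactly 4 M n^2 - 4 m.  When
   r, s <> 0 we have |G| <= 4 M, so the second bound gains (Im G)^2 / (8 M).

   Now 2 i Im G is the transform of D(u, v) = e(u, v) - e(tau u, tau v), where
   tau is induced by x |-> - x.  As N is odd, tau is a fixed-point-free
   involution, so D <> 0.  By Parseval, 4 sum_(r, s <> 0) (Im G)^2 is at least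
   N (N sum D^2 - 2 sum_x (sum_y D(x, y))^2), and this is at least 2 N^2. *)
Require Import Defs.
From mathcomp Require Import all_boot all_order all_algebra.
From mathcomp Require Import complex zify ring lra.
From mathcomp Require Import boolp reals trigo.

Import Order.TTheory GRing.Theory Num.Theory.
Local Open Scope ring_scope.

Local Notation Re := complex.Re.
Local Notation Im := complex.Im.

(** * Energy of a symmetric matrix that is odd under a fixed-point-free involution *)

Section Deviation.
Variables (R : realFieldType) (V : finType).
Implicit Types (g : V -> R) (D : V -> V -> R).

Lemma ler_sum_uniq g (s : seq V) :
  uniq s -> (forall v, 0 <= g v) -> \sum_(v <- s) g v <= \sum_v g v.
Proof.
move=> us g0; rewrite big_uniq //= [leRHS](bigID (mem s)) /= lerDl.
exact: sumr_ge0.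
Qed.

Definition deviation g : R :=
  #|V|.+1%:R * (\sum_v g v ^+ 2) - (\sum_v g v) ^+ 2.

(* [g] is extended by the value 0 at one extra point; [mu] is the mean of the
   extension. *)
Lemma deviationE g (mu := (\sum_v g v) / #|V|.+1%:R) :
  deviation g = #|V|.+1%:R * (\sum_v (g v - mu) ^+ 2 + mu ^+ 2).
Proof.
have -> : \sum_v (g v - mu) ^+ 2
    = \sum_v g v ^+ 2 - 2 * mu * (\sum_v g v) + #|V|%:R * mu ^+ 2.
  have <- : \sum_(v : V) mu ^+ 2 = #|V|%:R * mu ^+ 2 by rewrite sumr_const mulr_natl.
  rewrite mulr_sumr -sumrB -big_split.
  by apply: eq_bigr => v _ /=; ring.
have N0 : #|V|.+1%:R != 0 :> R by rewrite pnatr_eq0.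
have -> : #|V|%:R = #|V|.+1%:R - 1 :> R by rewrite -natr1 addrK.
rewrite /deviation /mu; move: (_.+1%:R) N0 => N N0; field; exact: N0.
Qed.

Lemma deviation_ge0 g : 0 <= deviation g.
Proof.
by rewrite deviationE mulr_ge0 // addr_ge0 ?sqr_ge0 // sumr_ge0 // => v _; exact: sqr_ge0.
Qed.

(* The mean square deviation of (t, t, 0, 0, 0) is 6/5 t^2, the fifth point
   being the extra one. *)
Lemma deviation_ge g a b c d :
    uniq [:: a; b; c; d] -> g b = g a -> g c = 0 -> g d = 0 ->
  6 / 5 * #|V|.+1%:R * g a ^+ 2 <= deviation g.
Proof.
move=> us gb gc gd; rewrite deviationE; set mu := _ / #|V|.+1%:R.
rewrite mulrC mulrA mulrC ler_pM2l ?ltr0n //.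
have := @ler_sum_uniq (fun v => (g v - mu) ^+ 2) _ us (fun v => sqr_ge0 _).
rewrite !big_cons big_nil gb gc gd /=; set S := \sum_v _.
(* With t = [g a], the five squares add up to 2 (t - mu)^2 + 3 mu^2 = 5 (mu - 2t/5)^2 + 6t^2/5. *)
by have := sqr_ge0 (mu - 2 / 5 * g a); nra.
Qed.

(* Symmetrising D in its second variable gives E, whose rows x have total
   deviation twice the right-hand side.  Row x of E vanishes at x and tau x and
   takes equal values at y and tau y, so [deviation_ge] applies; the four rows
   x0, tau x0, y0, tau y0 suffice because E(x0, y0)^2 + E(y0, x0)^2
   = 2 D(x0, y0)^2 + 2 D(x0, tau y0)^2. *)
Lemma reflection_energy_ge D (tau : V -> V) (x0 y0 : V) :
    involutive tau -> (forall v, tau v != v) ->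
    (forall x y, D x y = D y x) -> (forall x, D x x = 0) ->
    (forall x y, D (tau x) (tau y) = - D x y) -> 1 <= D x0 y0 ^+ 2 ->
  2 * #|V|.+1%:R <= #|V|.+1%:R * (\sum_x \sum_y D x y ^+ 2)
                    - 2 * \sum_x (\sum_y D x y) ^+ 2.
Proof.
move=> tauK tauN Dsym Dxx Dtau D1.
have tauI := inv_inj tauK.
have Dxt x : D x (tau x) = 0.
  by have := Dtau x (tau x); rewrite tauK Dsym; lra.
have Dl x y : D (tau x) y = - D x (tau y) by rewrite -Dtau tauK.
pose E x y := D x y + D x (tau y).
have reix (f : V -> R) : \sum_y f (tau y) = \sum_y f y.
  by rewrite [RHS](reindex_inj tauI).
have sE x : \sum_y E x y = 2 * \sum_y D x y.
  by rewrite big_split /= (reix (D x)); lra.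
(* Exchanging x and y reverses the sign, since D(y, tau x) = D(tau x, y) = - D(x, tau y). *)
have cross0 : \sum_x \sum_y D x y * D x (tau y) = 0.
  have : \sum_x \sum_y D x y * D x (tau y) = - \sum_x \sum_y D x y * D x (tau y).
    rewrite {1}exchange_big -sumrN; apply: eq_bigr => x _.
    rewrite -sumrN; apply: eq_bigr => y _.
    by rewrite [D y x]Dsym [D y _]Dsym Dl mulrN.
  lra.
have sE2 : \sum_x \sum_y E x y ^+ 2 = 2 * \sum_x \sum_y D x y ^+ 2.
  transitivity (\sum_x (2 * (\sum_y D x y ^+ 2) + 2 * \sum_y D x y * D x (tau y))).
    apply: eq_bigr => x _.
    rewrite mulr_natl mulr2n -{2}(reix (fun y => D x y ^+ 2)) mulr_sumr -!big_split.
    by apply: eq_bigr => y _ /=; rewrite /E; ring.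
  by rewrite big_split /= -!mulr_sumr cross0 mulr0 addr0.
have sdev : \sum_x deviation (E x)
    = 2 * (#|V|.+1%:R * (\sum_x \sum_y D x y ^+ 2) - 2 * \sum_x (\sum_y D x y) ^+ 2).
  rewrite sumrB -mulr_sumr sE2; under [X in _ - X]eq_bigr do rewrite sE exprMn.
  by rewrite -mulr_sumr; ring.
have D0 : D x0 y0 != 0 by apply/eqP => D0; move: D1; rewrite D0; lra.
have nxy : x0 != y0 by apply: contraNneq D0 => ->; rewrite Dxx.
have nxty : x0 != tau y0.
  by apply: contraNneq D0 => ->; rewrite Dsym Dxt.
have ntxy : tau x0 != y0 by rewrite (can2_eq tauK tauK).
have us x y : x != y -> x != tau y -> uniq [:: y; tau y; x; tau x].
  move=> xy xty; have yx : y != x by rewrite eq_sym.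
  have ytx : y != tau x by rewrite eq_sym (can2_eq tauK tauK).
  by rewrite /= !inE !negb_or (inj_eq tauI) yx ytx ![_ == tau _]eq_sym !tauN eq_sym xty.
have row x y : x != y -> x != tau y ->
    6 / 5 * #|V|.+1%:R * E x y ^+ 2 <= deviation (E x).
  move=> xy xty; apply: (deviation_ge _ _ _ _ _ (us _ _ xy xty)); rewrite /E ?tauK ?Dxx ?Dxt;
    lra.
have := @ler_sum_uniq (fun x => deviation (E x)) _ (us _ _ nxy nxty)
  (fun x => deviation_ge0 _).
rewrite sdev !big_cons big_nil.
have r1 := row _ _ nxy nxty.
(* Rows x0 and tau x0 of [E] are opposite, so both are bounded by the same square; likewise for y0
   and tau y0. *)
have r2 : 6 / 5 * #|V|.+1%:R * E x0 y0 ^+ 2 <= deviation (E (tau x0)).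
  have := row (tau x0) y0 ntxy; rewrite (inj_eq tauI) => /(_ nxy).
  by rewrite /E !Dl tauK; nra.
have r3 : 6 / 5 * #|V|.+1%:R * E y0 x0 ^+ 2 <= deviation (E y0).
  by apply: row; rewrite 1?eq_sym.
have r4 : 6 / 5 * #|V|.+1%:R * E y0 x0 ^+ 2 <= deviation (E (tau y0)).
  have := row (tau y0) x0; rewrite (inj_eq tauI) !(eq_sym _ x0) => /(_ nxty nxy).
  by rewrite /E !Dl tauK; nra.
have N0 : 0 < #|V|.+1%:R :> R by rewrite ltr0n.
have EE : 2 <= E x0 y0 ^+ 2 + E y0 x0 ^+ 2.
  rewrite /E [D y0 x0]Dsym [D y0 _]Dsym Dl.
  have := sqr_ge0 (D x0 (tau y0)); nra.
(* With N = |V| + 1, the four rows give 24N/5 as a lower bound for twice the right-hand side, and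
   12N/5 >= 2N. *)
nra.
Qed.

End Deviation.

(** * Real parts and moduli of complex numbers *)

Section ComplexFacts.
Local Open Scope complex_scope.
Variable R : rcfType.
Implicit Types (z : R[i]) (M : R).

Lemma Re_sum (I : finType) (P : pred I) (F : I -> R[i]) :
  Re (\sum_(i | P i) F i) = \sum_(i | P i) Re (F i).
Proof.
have ReD : {morph @Re R : x y / x + y >-> x + y} by move=> [a b] [c d].
exact: (big_morph _ ReD).
Qed.

Lemma normc_sqr z : Normc.normc z ^+ 2 = Re z ^+ 2 + Im z ^+ 2.
Proof. by case: z => a b /=; rewrite sqr_sqrtr ?addr_ge0 ?sqr_ge0. Qed.

Lemma normc_ge0 z : 0 <= Normc.normc z.
Proof. by case: z => a b; exact: sqrtr_ge0. Qed.

Lemma Re_le_normc z : Re z <= Normc.normc z.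
Proof. by have := normc_sqr z; have := normc_ge0 z; have := sqr_ge0 (Im z); nra. Qed.

(** (Im z)^2 = (|z| + Re z)(|z| - Re z), and the second factor is at most 2|z| <= 8M. *)
Lemma normc_ge_ReIm z M :
  0 < M -> Normc.normc z <= 4 * M ->
  - Re z + Im z ^+ 2 / (8 * M) <= Normc.normc z.
Proof.
move=> M0 zM; have nz := normc_sqr z; have n0 := normc_ge0 z.
rewrite addrC -lerBrDr opprK ler_pdivrMr; last by lra.
have r1 := Re_le_normc z; have i0 := sqr_ge0 (Im z).
have r2 : 0 <= Normc.normc z + Re z by nra.
have : 0 <= (Normc.normc z + Re z) * (8 * M - (Normc.normc z - Re z)).
  by apply: mulr_ge0 => //; lra.
nra.
Qed.

Lemma normc_sum (I : finType) (F : I -> R[i]) :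
  Normc.normc (\sum_i F i) <= \sum_i Normc.normc (F i).
Proof.
have := ler_norm_sum (index_enum I) F xpredT.
have -> : \sum_i `|F i| = (\sum_i Normc.normc (F i))%:C by rewrite rmorph_sum.
by rewrite lecR.
Qed.

Lemma normc_real (a : R) : 0 <= a -> Normc.normc a%:C = a.
Proof. by move=> a0; rewrite /= expr0n addr0 sqrtr_sqr ger0_norm. Qed.

Lemma subcJ_energy z : (z - conjc z) * conjc (z - conjc z) = (4 * Im z ^+ 2)%:C.
Proof.
case: z => a b; apply/eqP; rewrite eq_complex /=.
by apply/andP; split; apply/eqP; ring.
Qed.

End ComplexFacts.

(** * Parseval identities with the trivial character removed *)

Section Characters.
Local Open Scope complex_scope.
Variables (R : rcfType) (I : finType) (o : I).

Section Energy.
Variables (T : finType) (N : nat) (chi : I -> T -> R[i]).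
Hypothesis chi_o : forall v, chi o v = 1.
Hypothesis chi_orth : forall u v, \sum_r chi r u * conjc (chi r v) = (N * (u == v))%:R.

Lemma parseval (f : T -> R[i]) :
  \sum_r (\sum_u f u * chi r u) * conjc (\sum_u f u * chi r u)
  = N%:R * \sum_u f u * conjc (f u).
Proof.
under eq_bigr do rewrite rmorph_sum big_distrlr /=.
rewrite exchange_big mulr_sumr; apply: eq_bigr => u _ /=.
rewrite exchange_big (bigD1 u) //= [X in _ + X]big1 ?addr0 => [|v vu].
  under eq_bigr do rewrite rmorphM mulrACA.
  by rewrite -mulr_sumr chi_orth eqxx muln1 mulrC.
under eq_bigr do rewrite rmorphM mulrACA.
by rewrite -mulr_sumr chi_orth eq_sym (negPf vu) muln0 mulr0.
Qed.

Lemma parseval_off (f : T -> R[i]) :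
  \sum_(r | r != o) (\sum_u f u * chi r u) * conjc (\sum_u f u * chi r u)
  = N%:R * (\sum_u f u * conjc (f u)) - (\sum_u f u) * conjc (\sum_u f u).
Proof.
have s0 : \sum_u f u * chi o u = \sum_u f u.
  by apply: eq_bigr => u _; rewrite chi_o mulr1.
by rewrite -parseval (bigD1 o (P := xpredT)) //= s0 addrAC subrr add0r.
Qed.

(** [parseval_off] is applied in v for fixed r, then in u. As [chi o] is 1, dropping r = o and s = o
    subtracts the column-sum and row-sum terms; the corner (o, o), subtracted twice, is added
    back. *)
Lemma parseval2_off (D : T -> T -> R[i])
    (F := fun r s => \sum_u \sum_v D u v * chi r u * chi s v) :
  \sum_(r | r != o) \sum_(s | s != o) F r s * conjc (F r s)
  = N%:R ^+ 2 * (\sum_u \sum_v D u v * conjc (D u v))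
    - N%:R * (\sum_v (\sum_u D u v) * conjc (\sum_u D u v))
    - N%:R * (\sum_u (\sum_v D u v) * conjc (\sum_v D u v))
    + (\sum_u \sum_v D u v) * conjc (\sum_u \sum_v D u v).
Proof.
transitivity (\sum_(r | r != o) (N%:R * (\sum_v (\sum_u D u v * chi r u)
                                          * conjc (\sum_u D u v * chi r u))
   - (\sum_u (\sum_v D u v) * chi r u) * conjc (\sum_u (\sum_v D u v) * chi r u))).
  apply: eq_bigr => r _.
  have -> : \sum_u (\sum_v D u v) * chi r u = \sum_v \sum_u D u v * chi r u.
    by rewrite exchange_big; apply: eq_bigr => u _; rewrite mulr_suml.
  rewrite -parseval_off; apply: eq_bigr => s _.
  have -> // : F r s = \sum_v (\sum_u D u v * chi r u) * chi s v.
  by rewrite /F exchange_big; apply: eq_bigr => u _; rewrite mulr_suml.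
rewrite sumrB parseval_off -mulr_sumr exchange_big /=.
under eq_bigr do rewrite parseval_off.
rewrite sumrB -mulr_sumr [X in _ * (_ * X - _)]exchange_big /=.
by ring.
Qed.

End Energy.
End Characters.

Lemma sum_option (A : nmodType) (V : finType) (F : option V -> A) :
  \sum_u F u = F None + \sum_v F (Some v).
Proof.
rewrite (bigD1 None) //=; congr (_ + _).
rewrite (reindex_omap Some id) //=; first by apply: eq_bigl => v; rewrite eqxx.
by case.
Qed.

(** * Fourier coefficients of the cone, for abstract characters *)

Section ConeSpectrum.
Local Open Scope complex_scope.
Variables (R : rcfType) (I V : finType) (e : rel V) (tau : V -> V) (M : R).
Variables (W : option V -> option V -> R) (o : I) (chi : I -> option V -> R[i]).
Let n := #|V|.
Let m : R := (\sum_u \sum_v (e u v)%:R) / 2.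
Hypothesis simple_e : simple_graph e.
Hypothesis W00 : W None None = 0.
Hypothesis W01 : forall v, W None (Some v) = M.
Hypothesis W10 : forall v, W (Some v) None = M.
Hypothesis W11 : forall u v, W (Some u) (Some v) = (e u v)%:R.
Hypothesis M_gt_m : m < M.
Hypothesis chi_o : forall u, chi o u = 1.
Hypothesis chi_None : forall r, chi r None = 1.
Hypothesis chi_orth :
  forall u v, \sum_r chi r u * conjc (chi r v) = (n.+1 * (u == v))%:R.
Hypothesis chi_sum : forall r, r != o -> \sum_u chi r u = 0.
Hypothesis chi_unit : forall r u, Normc.normc (chi r u) = 1.
Hypothesis tauK : involutive tau.
Hypothesis tauN : forall v, tau v != v.
Hypothesis chi_tau : forall r v, chi r (Some (tau v)) = conjc (chi r (Some v)).

(** [coef] is the G of the opening comment; [A] is the contribution of the edges of H. *)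
Let coef r s : R[i] := \sum_u \sum_v (W u v)%:C * chi r u * chi s v.
Let A r s : R[i] :=
  \sum_u \sum_v (e u v)%:R * chi r (Some u) * chi s (Some v).

Let two_m : 2 * m = \sum_u \sum_v (e u v)%:R.
Proof. by rewrite /m mulrCA divff ?pnatr_eq0 // mulr1. Qed.

Let M_gt0 : 0 < M.
Proof.
apply: le_lt_trans M_gt_m; rewrite divr_ge0 // sumr_ge0 // => u _.
by rewrite sumr_ge0.
Qed.

Lemma coefE r s : coef r s =
  M%:C * (\sum_v chi r (Some v) + \sum_v chi s (Some v)) + A r s.
Proof.
have -> : coef r s = \sum_v M%:C * chi s (Some v)
    + (\sum_u M%:C * chi r (Some u)
       + \sum_u \sum_v (W (Some u) (Some v))%:C * chi r (Some u) * chi s (Some v)).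
  rewrite /coef !sum_option W00 rmorph0 !mul0r add0r; congr (_ + _).
    by apply: eq_bigr => v _; rewrite W01 chi_None mulr1.
  by rewrite -big_split; apply: eq_bigr => u _; rewrite sum_option W10 chi_None mulr1.
rewrite -!mulr_sumr mulrDr addrCA addrA; congr (_ + _).
apply: eq_bigr => u _; apply: eq_bigr => v _.
by rewrite W11 rmorph_nat.
Qed.

(** A nontrivial character sums to 0 and is 1 at the apex, hence sums to -1 over V. *)
Lemma coef_off r s : r != o -> s != o -> coef r s = - (2 * M)%:C + A r s.
Proof.
have off t : t != o -> \sum_v chi t (Some v) = -1.
  move=> to; have := chi_sum _ to; rewrite sum_option chi_None => /eqP.
  by rewrite addrC addr_eq0 => /eqP.
move=> ro so; rewrite coefE !off // rmorphM /= rmorph_nat; congr (_ + _); ring.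
Qed.

(** [A] is a sum of 2m unimodular terms, so |A| <= 2m < 2M. *)
Lemma normc_coef_off r s : r != o -> s != o -> Normc.normc (coef r s) <= 4 * M.
Proof.
move=> ro so; rewrite coef_off //; apply: le_trans (le_normcD _ _) _.
rewrite normcN normc_real; last by have := M_gt0; lra.
have : Normc.normc (A r s) <= 2 * m.
  rewrite two_m.
  apply: le_trans (normc_sum _ _ _) _; apply: ler_sum => u _.
  apply: le_trans (normc_sum _ _ _) _; apply: ler_sum => v _.
  rewrite !Normc.normcM !chi_unit !mulr1.
  by rewrite -[_%:R in leLHS](rmorph_nat (real_complex R)) normc_real.
have := M_gt_m; lra.
Qed.

Let D u v : R := (e u v)%:R - (e (tau u) (tau v))%:R.

(** Conjugating a character composes it with [tau], so reindexing by [tau] moves the conjugation of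
    [A] onto [e]. The apex term is real and cancels. *)
Lemma coef_subJ r s : r != o -> s != o ->
  coef r s - conjc (coef r s) =
  \sum_u \sum_v (D u v)%:C * chi r (Some u) * chi s (Some v).
Proof.
move=> ro so.
have -> : conjc (coef r s) = - (2 * M)%:C
    + \sum_u \sum_v (e (tau u) (tau v))%:R * chi r (Some u) * chi s (Some v).
  rewrite coef_off // rmorphD; congr (_ + _); first by rewrite -rmorphN; exact: conjc_real.
  rewrite /A rmorph_sum (reindex_inj (inv_inj tauK)); apply: eq_bigr => u _ /=.
  rewrite rmorph_sum (reindex_inj (inv_inj tauK)); apply: eq_bigr => v _ /=.
  by rewrite !rmorphM /= -!chi_tau !tauK rmorph_nat.
rewrite coef_off // opprD addrACA subrr add0r -sumrB; apply: eq_bigr => u _.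
rewrite -sumrB; apply: eq_bigr => v _.
by rewrite rmorphB /= !rmorph_nat; ring.
Qed.

Lemma sum_Im_coef :
  (exists u v, e (tau u) (tau v) != e u v) ->
  n.+1%:R ^+ 2 / 2 <= \sum_(r | r != o) \sum_(s | s != o) Im (coef r s) ^+ 2.
Proof.
move=> [x0 [y0 exy]].
have Dsym u v : D u v = D v u.
  by rewrite /D; case: simple_e => esym _; rewrite esym (esym (tau u)).
have en : 2 * n.+1%:R <= n.+1%:R * (\sum_x \sum_y D x y ^+ 2)
                         - 2 * \sum_x (\sum_y D x y) ^+ 2.
  apply: (reflection_energy_ge _ _ _ tau x0 y0) => //.
  - by move=> x; rewrite /D; case: simple_e => _ eirr; rewrite !eirr subrr.
  - by move=> x y; rewrite /D !tauK opprB.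
  by move: exy; rewrite /D; do 2!case: (e _ _) => //=; nra.
have P : 4 * (\sum_(r | r != o) \sum_(s | s != o) Im (coef r s) ^+ 2)
    = n.+1%:R ^+ 2 * (\sum_u \sum_v D u v ^+ 2)
    - n.+1%:R * (\sum_v (\sum_u D u v) ^+ 2)
    - n.+1%:R * (\sum_u (\sum_v D u v) ^+ 2)
    + (\sum_u \sum_v D u v) ^+ 2.
  apply: complexI.
  (* The characters are restricted to V, where they are still orthogonal over r with factor n +
     1. *)
  have := parseval2_off _ _ o _ n.+1 (fun r v => chi r (Some v))
    (fun v => chi_o (Some v)) _ (fun u v => (D u v)%:C).
  move=> /(_ (fun u v => chi_orth (Some u) (Some v))) => P.
  transitivity (\sum_(r | r != o) \sum_(s | s != o)
      (coef r s - conjc (coef r s)) * conjc (coef r s - conjc (coef r s))).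
    rewrite mulr_sumr rmorph_sum; apply: eq_bigr => r _.
    rewrite mulr_sumr rmorph_sum; apply: eq_bigr => s _.
    by rewrite subcJ_energy.
  transitivity (n.+1%:R ^+ 2 * (\sum_u \sum_v (D u v)%:C * conjc (D u v)%:C) -
      n.+1%:R * (\sum_v (\sum_u (D u v)%:C) * conjc (\sum_u (D u v)%:C)) -
      n.+1%:R * (\sum_u (\sum_v (D u v)%:C) * conjc (\sum_v (D u v)%:C)) +
      (\sum_u \sum_v (D u v)%:C) * conjc (\sum_u \sum_v (D u v)%:C)).
    rewrite -P; apply: eq_bigr => r ro; apply: eq_bigr => s so.
    by rewrite coef_subJ.
  have sqC (x : R) : x%:C * conjc x%:C = (x ^+ 2)%:C by rewrite conjc_real rmorphXn.
  rewrite rmorphD !rmorphB; congr (_ - _ - _ + _).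
  - rewrite rmorphM rmorphXn rmorph_nat rmorph_sum; congr (_ * _).
    apply: eq_bigr => u _; rewrite rmorph_sum.
    by apply: eq_bigr => v _; exact: sqC.
  - rewrite rmorphM rmorph_nat rmorph_sum; congr (_ * _).
    by apply: eq_bigr => u _; rewrite -rmorph_sum; exact: sqC.
  - rewrite rmorphM rmorph_nat rmorph_sum; congr (_ * _).
    by apply: eq_bigr => u _; rewrite -rmorph_sum; exact: sqC.
  have -> : \sum_u \sum_v (D u v)%:C = (\sum_u \sum_v D u v)%:C.
    by rewrite rmorph_sum; apply: eq_bigr => u _; rewrite rmorph_sum.
  exact: sqC.
have cols : \sum_v (\sum_u D u v) ^+ 2 = \sum_u (\sum_v D u v) ^+ 2.
  by apply: eq_bigr => v _; congr (_ ^+ 2); apply: eq_bigr => u _; exact: Dsym.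
(* With N = n + 1: 4X = N^2 S2 - 2N S1 + (sum D)^2 >= N (N S2 - 2 S1) >= 2N^2. *)
move: P; rewrite cols; have := sqr_ge0 (\sum_u \sum_v D u v).
have N0 : 0 < n.+1%:R :> R by rewrite ltr0n.
move: en; rewrite -(ler_pM2l N0); move: n.+1%:R N0 => N N0.
set S2 := \sum_x \sum_y _; set S1 := \sum_x _ ^+ 2; set X := \sum_(r | _) _.
by move=> en s0 P; lra.
Qed.

(** The sign is 1 - 2 [r != o][s != o]. Each of the two resulting sums is the quadratic form of W at
    the vector of character sums: [a] over all r, and a - 1 over r != o. *)
Lemma sum_sign_coef :
  \sum_r \sum_s (if (r == o) || (s == o) then 1 else -1) * Re (coef r s)
  = 4 * M * n%:R ^+ 2 - 4 * m.
Proof.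
pose a (u : option V) : R := (n.+1 * (u == None))%:R.
have sa u : \sum_r chi r u = (a u)%:C.
  rewrite rmorph_nat -chi_orth; apply: eq_bigr => r _.
  by rewrite chi_None conjc1 mulr1.
have sa1 u : \sum_(r | r != o) chi r u = (a u - 1)%:C.
  have := sa u; rewrite (bigD1 o) //= chi_o => sau; apply: (addrI 1).
  by rewrite sau -[1 in RHS](rmorph1 (real_complex R)) -rmorphD addrC subrK.
have -> : \sum_r \sum_s (if (r == o) || (s == o) then 1 else -1) * Re (coef r s)
    = \sum_r \sum_s Re (coef r s)
      - 2 * \sum_(r | r != o) \sum_(s | s != o) Re (coef r s).
  rewrite [X in _ - _ * X]big_mkcond mulr_sumr -sumrB; apply: eq_bigr => r _ /=.
  case: eqP => [_|_] /=.
    by rewrite mulr0 subr0; apply: eq_bigr => s _; rewrite mul1r.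
  rewrite [X in _ - _ * X]big_mkcond mulr_sumr -sumrB; apply: eq_bigr => s _ /=.
  by case: eqP => [_|_] /=; ring.
have sumP (P : pred I) (b : option V -> R) :
    (forall u, \sum_(r | P r) chi r u = (b u)%:C) ->
    \sum_(r | P r) \sum_(s | P s) Re (coef r s)
      = \sum_u \sum_v W u v * b u * b v.
  move=> sb; transitivity (Re (\sum_(r | P r) \sum_(s | P s) coef r s)).
    by rewrite Re_sum; apply: eq_bigr => r _; rewrite Re_sum.
  rewrite -[RHS]/(Re (_%:C)); congr Re.
  transitivity (\sum_u \sum_v \sum_(r | P r) \sum_(s | P s) (W u v)%:C * chi r u * chi s v).
    under eq_bigr do rewrite exchange_big; rewrite exchange_big; apply: eq_bigr => u _.
    by under eq_bigr do rewrite exchange_big; rewrite exchange_big.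
  rewrite rmorph_sum; apply: eq_bigr => u _.
  rewrite rmorph_sum; apply: eq_bigr => v _.
  under eq_bigr do rewrite -mulr_sumr sb.
  by rewrite -mulr_suml -mulr_sumr sb !rmorphM.
rewrite (sumP xpredT a) // (sumP (fun r => r != o) (fun u => a u - 1)) //.
have aS v : a (Some v) = 0 by rewrite /a muln0.
have a0 : a None = n%:R + 1 by rewrite /a eqxx muln1 natr1.
have quad (b : option V -> R) c : (forall v, b (Some v) = c) ->
    \sum_u \sum_v W u v * b u * b v = 2 * n%:R * M * b None * c + 2 * m * c ^+ 2.
  move=> bS; rewrite !sum_option W00 !mul0r add0r.
  have -> : \sum_v W None (Some v) * b None * b (Some v) = n%:R * (M * b None * c).
    under eq_bigr do rewrite W01 bS.
    by rewrite sumr_const mulr_natl.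
  have -> : \sum_u \sum_v W (Some u) v * b (Some u) * b v
      = n%:R * (M * c * b None) + 2 * m * c ^+ 2.
    under eq_bigr do rewrite sum_option W10 bS.
    rewrite big_split /= sumr_const mulr_natl; congr (_ + _).
    rewrite two_m mulr_suml; apply: eq_bigr => u _.
    by rewrite mulr_suml; apply: eq_bigr => v _; rewrite W11 !bS expr2 mulrA.
  by ring.
(* The form vanishes at [a], which is 0 on V. The vector a - 1 is n at the apex and -1 on V, giving
   -2 (-2Mn^2 + 2m). *)
rewrite (quad _ 0 aS) (quad _ (-1)) => [|v]; last by rewrite aS sub0r.
by rewrite a0; ring.
Qed.

Lemma sum_normc_coef_ge :
  (exists u v, e (tau u) (tau v) != e u v) ->
  4 * M * n%:R ^+ 2 - 4 * m + n.+1%:R ^+ 2 / (16 * M)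
  <= \sum_r \sum_s Normc.normc (coef r s).
Proof.
move=> ntau.
(* The gain from [normc_ge_ReIm], available only off the row and the column of o. *)
pose x r s := if (r == o) || (s == o) then 0 else Im (coef r s) ^+ 2 / (8 * M).
have lex : n.+1%:R ^+ 2 / (16 * M) <= \sum_r \sum_s x r s.
  apply: (@le_trans _ _ ((\sum_(r | r != o) \sum_(s | s != o) Im (coef r s) ^+ 2) / (8 * M))).
    have -> : n.+1%:R ^+ 2 / (16 * M) = n.+1%:R ^+ 2 / 2 / (8 * M).
      by field; rewrite gt_eqF // M_gt0.
    by rewrite ler_pM2r ?sum_Im_coef // invr_gt0; have := M_gt0; lra.
  rewrite mulr_suml big_mkcond; apply: ler_sum => r _; rewrite /x.
  case: eqP => _ /=; first by rewrite sumr_ge0.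
  by rewrite mulr_suml big_mkcond; apply: ler_sum => s _; case: eqP.
rewrite -sum_sign_coef; apply: le_trans (lerD (lexx _) lex) _.
rewrite -big_split; apply: ler_sum => r _; rewrite -big_split; apply: ler_sum => s _ /=.
rewrite /x; case: eqP => [_|/eqP ro] /=; first by rewrite mul1r addr0 Re_le_normc.
case: eqP => [_|/eqP so] /=; first by rewrite mul1r addr0 Re_le_normc.
by rewrite mulN1r normc_ge_ReIm ?M_gt0 // normc_coef_off.
Qed.

End ConeSpectrum.

(** * The exponential and sums of roots of unity *)

Section ExpI.
Local Open Scope complex_scope.
Variable R : realType.
Implicit Types (t : R).

Lemma expiD t s : expi (t + s) = expi t * expi s.
Proof.
by rewrite /expi cosD sinD; apply/eqP; rewrite eq_complex /= addrC eqxx /= [eqbLHS]addrC addrC eqxx.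
Qed.

Lemma expi0 : expi (0 : R) = 1.
Proof. by rewrite /expi cos0 sin0. Qed.

Lemma expiN t : expi (- t) = conjc (expi t).
Proof. by rewrite /expi cosN sinN. Qed.

Lemma normc_expi t : Normc.normc (expi t) = 1.
Proof. by rewrite /= cos2Dsin2 sqrtr1. Qed.

Lemma expiM_nat k t : expi (k%:R * t) = expi t ^+ k.
Proof.
elim: k => [|k IH]; first by rewrite mul0r expi0 expr0.
by rewrite -natr1 mulrDl mul1r expiD IH exprSr.
Qed.

Lemma expi_2pi_nat k : expi (2 * pi * k%:R : R) = 1.
Proof.
rewrite mulrC expiM_nat; suff -> : expi (2 * pi : R) = 1 by rewrite expr1n.
by rewrite mulr_natl /expi cos2pi sin2pi.
Qed.

Lemma expi_neq1 t : 0 < t < pi -> expi (2 * t) != 1.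
Proof.
move=> /sin_gt0_pi st; rewrite eq_complex /= negb_and; apply/orP; left.
rewrite mulr_natl cos_mulr2n; have := cos2Dsin2 t.
by apply: contra_eqN => /eqP; nra.
Qed.

(** For a != b this is a geometric sum whose ratio z satisfies z^N = 1 and z != 1. *)
Lemma sum_expi N (a b : 'I_N) :
  \sum_(r < N) expi (- (2 * pi * r%:R * (a%:R - b%:R) / N%:R) : R) = (N * (a == b))%:R.
Proof.
have [->|ab] := eqVneq a b.
  rewrite muln1 -[N in RHS]card_ord -sumr_const; apply: eq_bigr => r _.
  by rewrite subrr mulr0 mul0r oppr0 expi0.
have N0 : N%:R != 0 :> R by rewrite pnatr_eq0; case: N a b {ab} => [[]|].
have Np : 0 < N%:R :> R by rewrite lt_def N0 ler0n.
rewrite muln0; set z := expi (- (2 * pi * (a%:R - b%:R) / N%:R) : R).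
under eq_bigr => r _.
  rewrite [X in expi X](_ : _ = r%:R * - (2 * pi * (a%:R - b%:R) / N%:R)); last by field.
  rewrite expiM_nat -/z; over.
have zN : z ^+ N = 1.
  rewrite -expiM_nat (_ : _ * _ = - (2 * pi * a%:R) + 2 * pi * b%:R); last by field.
  by rewrite expiD expiN !expi_2pi_nat conjc1 mulr1.
(* The angle is 2t with t = pi (d - c) / N strictly between 0 and pi. The opposite order of indices
   follows by conjugation. *)
have zneq (c d : 'I_N) : (c < d)%N -> expi (2 * pi * (d%:R - c%:R) / N%:R : R) != 1.
  move=> cd; rewrite (_ : _ / _ = 2 * (pi * (d - c)%N%:R / N%:R)); last first.
    by rewrite natrB; [field|exact: ltnW].
  apply: expi_neq1; rewrite divr_gt0 ?mulr_gt0 ?pi_gt0 ?Np ?ltr0n ?subn_gt0 //=.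
  rewrite ltr_pdivrMr // ltr_pM2l ?pi_gt0 // ltr_nat.
  by apply: leq_ltn_trans (leq_subr _ _) (ltn_ord d).
have z1 : z - 1 != 0.
  rewrite subr_eq0; move: ab; rewrite -val_eqE /= neq_ltn => /orP[ab|ba].
    have -> : z = expi (2 * pi * (b%:R - a%:R) / N%:R) by congr expi; field.
    exact: zneq.
  rewrite /z expiN; apply: contra (zneq _ _ ba) => /eqP h.
  by rewrite -[expi _]conjcK h conjc1.
by apply: (mulfI z1); rewrite -subrX1 zN subrr mulr0.
Qed.

End ExpI.

(** * The reflection of Z_N about a point *)

Section Reflection.
Local Open Scope complex_scope.
Variables (N : nat) (a : 'I_N).

(** This is 2a - x modulo N; adding N keeps the natural subtraction from truncating. *)
Definition reflect_ord (x : 'I_N) : 'I_N :=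
  Ordinal (ltn_pmod (a.*2 + N - x) (leq_ltn_trans (leq0n _) (ltn_ord a))).

(** Subtraction-free form of the congruence, suited to [lia] and to casting into R. *)
Lemma reflect_ordE (x : 'I_N) : exists k, (a.*2 + N = x + reflect_ord x + k * N)%N.
Proof.
exists ((a.*2 + N - x) %/ N)%N; rewrite /=.
rewrite -addnA [(_ %% _ + _)%N]addnC -divn_eq.
by have := ltn_ord x; lia.
Qed.

Lemma reflect_ordK : involutive reflect_ord.
Proof.
move=> x; have [k Ek] := reflect_ordE x; have [l El] := reflect_ordE (reflect_ord x).
apply/esym/ord_inj.
have : (x + k * N = reflect_ord (reflect_ord x) + l * N)%N by lia.
move/(congr1 (modn^~ N)); rewrite ![(_ + _ * N)%N]addnC !modnMDl !modn_small //.
Qed.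

Lemma reflect_ord_center : reflect_ord a = a.
Proof.
apply: val_inj => /=; rewrite -addnn addnAC addnK modnDr modn_small //.
Qed.

Lemma reflect_ord_fix (x : 'I_N) : odd N -> reflect_ord x = x -> x = a.
Proof.
move=> oddN fx; have [k] := reflect_ordE x; rewrite fx => Ek.
apply: val_inj => /=; have := ltn_ord x; have := ltn_ord a.
(* 2 (a - x) = (k - 1) N is smaller than 2N in absolute value, so k <= 2; parity of N leaves k =
   1. *)
move: Ek; case: k => [|[|[|k]]]; nia.
Qed.

Lemma expi_reflect_ord (R : realType) (r : nat) (x : 'I_N) :
  expi (- (2 * pi * r%:R * ((reflect_ord x)%:R - a%:R) / N%:R) : R)
  = conjc (expi (- (2 * pi * r%:R * (x%:R - a%:R) / N%:R))).
Proof.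
have [k /(congr1 (GRing.natmul (1 : R)))] := reflect_ordE x.
rewrite -addnn !natrD natrM => Ek.
have N0 : N%:R != 0 :> R by rewrite pnatr_eq0; have := ltn_ord a; lia.
have -> : (reflect_ord x)%:R - a%:R = - (x%:R - a%:R) + N%:R - k%:R * N%:R :> R by lra.
have -> : - (2 * pi * r%:R * (- (x%:R - a%:R) + N%:R - k%:R * N%:R) / N%:R)
    = - - (2 * pi * r%:R * (x%:R - a%:R) / N%:R)
      + 2 * pi * (r * k)%N%:R + - (2 * pi * r%:R) :> R.
  by rewrite natrM; field.
by rewrite !expiD expi_2pi_nat mulr1 [X in _ * X]expiN expi_2pi_nat conjc1 mulr1 expiN.
Qed.

End Reflection.

(** * Ordered adjacent pairs against edges *)

Section EdgeCount.
Variables (V : finType) (e : rel V).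
Hypothesis simple_e : simple_graph e.

(** The fibre of (u, v) |-> {u, v} over an edge {x, y} consists of (x, y) and (y, x), distinct by
    irreflexivity. *)
Lemma sum_edges : (\sum_u \sum_v e u v = 2 * #|edges e|)%N.
Proof.
case: simple_e => esym eirr; rewrite pair_big /=.
have -> : (\sum_(uv : V * V) e uv.1 uv.2 = \sum_(uv in [set uv : V * V | e uv.1 uv.2]) 1)%N.
  by rewrite [RHS]big_mkcond; apply: eq_bigr => uv _; rewrite inE; case: e.
rewrite (partition_big_imset (fun uv : V * V => [set uv.1; uv.2])) /=.
have -> : [set [set uv.1; uv.2] | uv in [set uv : V * V | e uv.1 uv.2]] = edges e.
  by apply/setP => S; apply/imsetP/imsetP => -[uv]; rewrite ?inE => euv ->; exists uv; rewrite ?inE.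
rewrite mulnC -sum_nat_const; apply: eq_bigr => S /imsetP[[x y]].
rewrite inE /= => exy ->.
have nxy : x != y by apply: contraTneq exy => ->; rewrite eirr.
rewrite sum1_card; transitivity #|[set (x, y); (y, x)]|.
  apply: eq_card => -[u v]; rewrite !inE /= !xpair_eqE.
  apply/andP/orP => [[euv /eqP Suv]|[] /andP[/eqP -> /eqP ->]]; last 2 first.
  - by rewrite inE.
  - by rewrite inE /= esym setUC.
  have : u \in [set x; y] by rewrite -Suv !inE eqxx.
  have : v \in [set x; y] by rewrite -Suv !inE eqxx orbT.
  rewrite !inE => /orP[]/eqP ev /orP[]/eqP eu; move: euv;
    rewrite inE /= ev eu ?eirr // !eqxx; by [left|right].
by rewrite cards2 xpair_eqE negb_and nxy.
Qed.

End EdgeCount.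

(** * The bound for an arbitrary labeling of the cone *)

Section ConePhi.
Local Open Scope complex_scope.
Variables (R : realType) (V : finType) (e : rel V) (M : R).
Hypothesis simple_e : simple_graph e.

Lemma norm2_cone :
  norm2 (fun u v => (cone e M u v)%:C)
  = Num.sqrt (2 * #|V|%:R * M ^+ 2 + 2 * #|edges e|%:R).
Proof.
have sq (x : R) : Normc.normc x%:C ^+ 2 = x ^+ 2 by rewrite normc_sqr /= expr0n addr0.
rewrite /norm2; congr Num.sqrt.
have -> : \sum_u \sum_v Normc.normc (cone e M u v)%:C ^+ 2
    = \sum_u \sum_v cone e M u v ^+ 2.
  by apply: eq_bigr => u _; apply: eq_bigr => v _; exact: sq.
have E : \sum_u \sum_v (e u v)%:R ^+ 2 = 2 * #|edges e|%:R :> R.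
  rewrite -[2 * _](natrM _ 2) -sum_edges // natr_sum; apply: eq_bigr => u _.
  rewrite natr_sum; apply: eq_bigr => v _.
  by case: (e u v); rewrite ?expr1n ?expr0n.
rewrite !sum_option /= expr0n add0r sumr_const.
under eq_bigr do rewrite sum_option.
by rewrite big_split /= sumr_const E -mulr_natl; ring.
Qed.

Lemma fourier_norm1_cone_ge (p : {ffun 'I_#|{: option V}| -> option V}) :
    ~~ odd #|V| ->
    ~ (exists tau : V -> V, fpf_involutory_automorphism e tau) ->
    #|edges e|%:R < M -> labeling p ->
  (4 * M * #|V|%:R ^+ 2 - 4 * #|edges e|%:R) / #|V|.+1%:R + #|V|.+1%:R / (16 * M)
  <= fourier_norm1 (cone e M) p.
Proof.
move=> evenV no_fpf mM /asboolP [q pK qK].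
set N := #|{: option V}| in p q pK qK *.
have EN : N = #|V|.+1 by rewrite /N card_option.
have N0 : N%:R != 0 :> R by rewrite EN pnatr_eq0.
pose a := q None.
have Np : (0 < N)%N by rewrite EN.
pose o := Ordinal Np.
(* Labels are measured from the label a of the apex, so that every character is 1 there. *)
pose chi (r : 'I_N) u : R[i] :=
  expi (- (2 * pi * r%:R * ((q u)%:R - a%:R) / N%:R)).
have qI : injective q := can_inj qK.
have chi_o u : chi o u = 1 by rewrite /chi /= mulr0 !mul0r oppr0 expi0.
have chi_None r : chi r None = 1 by rewrite /chi subrr mulr0 mul0r oppr0 expi0.
have chi_orth u v : \sum_r chi r u * conjc (chi r v) = (#|V|.+1 * (u == v))%:R.
  rewrite -EN -(inj_eq qI) -sum_expi; apply: eq_bigr => r _.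
  by rewrite -expiN -expiD; congr expi; field.
have chi_sum r : r != o -> \sum_u chi r u = 0.
  move=> ro; rewrite (reindex p) /=; last by exists q => u _; [exact: pK|exact: qK].
  (* The exponent is symmetric in frequency and position, so [sum_expi] also sums over positions; o
     is the frequency 0. *)
  have := sum_expi R _ r o; rewrite (negPf ro) muln0 => s0.
  have -> : \sum_x chi r (p x) = expi (2 * pi * r%:R * a%:R / N%:R)
      * \sum_(x < N) expi (- (2 * pi * x%:R * (r%:R - o%:R) / N%:R)).
    rewrite mulr_sumr; apply: eq_bigr => x _; rewrite -expiD /chi pK; congr expi.
    by rewrite subr0; field.
  by rewrite s0 mulr0.
have chi_unit r u : Normc.normc (chi r u) = 1 by exact: normc_expi.
(* The reflection about the apex, carried to vertices. As N = n + 1 is odd, it fixes only the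
   apex. *)
pose sigma u := p (reflect_ord _ a (q u)).
have sigmaK : involutive sigma by move=> u; rewrite /sigma pK reflect_ordK qK.
have sigma0 : sigma None = None by rewrite /sigma reflect_ord_center qK.
have sigma_fix u : sigma u = u -> u = None.
  move/(congr1 q); rewrite pK => /reflect_ord_fix h; apply: qI; apply: h.
  by rewrite EN.
(* The default is never reached: [sigma] is an involution fixing [None], so it maps no [Some v] to
   [None]. *)
pose tau v := odflt v (sigma (Some v)).
have tauE v : Some (tau v) = sigma (Some v).
  rewrite /tau; case E : (sigma (Some v)) => [//|].
  by have := sigmaK (Some v); rewrite E sigma0.
have tauK : involutive tau.
  by move=> v; apply: Some_inj; rewrite !tauE sigmaK.
have tauN v : tau v != v.
  by apply/eqP => tv; have := sigma_fix (Some v); rewrite -tauE tv => /(_ erefl).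
have chi_tau r v : chi r (Some (tau v)) = conjc (chi r (Some v)).
  by rewrite tauE /chi /sigma pK expi_reflect_ord.
(* If [tau] preserved [e], it would be an automorphism excluded by [no_fpf]. *)
have ntau : exists u v, e (tau u) (tau v) != e u v.
  suff /existsP[u /existsP[v uv]] : [exists u, exists v, e (tau u) (tau v) != e u v].
    by exists u, v.
  apply: contraT => h; exfalso; apply: no_fpf; exists tau; split => //; split; first by exists tau.
  move=> u v; apply/eqP; apply: contraNT h => euv.
  by apply/existsP; exists u; apply/existsP; exists v.
have m2 : (\sum_u \sum_v (e u v)%:R) / 2 = #|edges e|%:R :> R.
  under eq_bigr do rewrite -natr_sum.
  by rewrite -natr_sum sum_edges // natrM mulrAC divff ?mul1r // pnatr_eq0.
have := sum_normc_coef_ge R _ _ e tau M (cone e M) o chi simple_e (erefl _)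
  (fun=> erefl _) (fun=> erefl _) (fun _ _ => erefl _).
rewrite m2 => /(_ mM chi_o chi_None chi_orth chi_sum chi_unit tauK tauN chi_tau ntau).
set S := \sum_r _ => lS.
have -> : fourier_norm1 (cone e M) p = S / N%:R.
  rewrite /fourier_norm1 /norm1 /S mulr_suml; apply: eq_bigr => r _.
  rewrite mulr_suml; apply: eq_bigr => s _.
  set C := \sum_u _.
  (* The two factors 1/sqrt N give 1/N, and measuring labels from a costs two phases of modulus
     1. *)
  have -> : (fourier_mx R N *m map_mx (real_complex R) (relabel (cone e M) p)
             *m fourier_mx R N) r s
    = (N%:R^-1)%:C * expi (- (2 * pi * r%:R * a%:R / N%:R))
      * expi (- (2 * pi * s%:R * a%:R / N%:R)) * C.
    have reix (F : option V -> R[i]) : \sum_u F u = \sum_x F (p x).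
      by rewrite (reindex p) //; exists q => u _; [exact: pK|exact: qK].
    rewrite mxE /C reix exchange_big reix mulr_sumr; apply: eq_bigr => y _.
    rewrite mxE mulr_suml mulr_sumr; apply: eq_bigr => x _; rewrite !mxE.
    have ch (t z : 'I_N) : expi (- (2 * pi * t%:R * z%:R / N%:R))
        = expi (- (2 * pi * t%:R * a%:R / N%:R)) * chi t (p z).
      by rewrite -expiD /chi pK; congr expi; field.
    have E : (N%:R^-1)%:C = ((Num.sqrt N%:R)^-1)%:C * ((Num.sqrt N%:R)^-1)%:C :> R[i].
      by rewrite -rmorphM -invfM -expr2 sqr_sqrtr.
    rewrite [_ * y%:R * s%:R]mulrAC (ch r x) (ch s y) E.
    have regroup (A : comPzRingType) (k w e1 c1 e2 c2 : A) :
      k * (e1 * c1) * w * (k * (e2 * c2)) = k * k * e1 * e2 * (w * c1 * c2) by ring.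
    exact: regroup.
  rewrite !Normc.normcM !normc_expi !mulr1 normc_real ?invr_ge0 //; exact: mulrC.
rewrite -EN; rewrite -EN in lS.
rewrite ler_pdivlMr ?ltr0n // mulrDl divfK //.
by move: lS; rewrite expr2 -mulrA [_ / _ * _]mulrAC.
Qed.

End ConePhi.

Theorem theorem4p7 (R : realType) (V : finType) (e : rel V) (n m : nat) (M : R)
    (simpleH : simple_graph e) (orderH : #|V| = n) (edgesH : #|edges e| = m)
    (n_even : ~~ odd n) (n_ge4 : (4 <= n)%N)
    (no_fpf : ~ exists tau : V -> V, fpf_involutory_automorphism e tau)
    (M_gt_m : m%:R < M) :
  let N : nat := n.+1 in
  let T : R := (4 * M * n%:R ^+ 2 - 4 * m%:R) / N%:R in
  let Q : R := Num.sqrt (2 * n%:R * M ^+ 2 + 2 * m%:R) in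
  T + N%:R / (16 * M) <= Phi (cone e M) /\
  T / Q + N%:R / (16 * M * Q) <= FRmin (cone e M).
Proof.
move=> N T Q.
have PhiT : T + N%:R / (16 * M) <= Phi (cone e M).
  have [p lp ->] := Phi_attained (cone e M).
  rewrite /T /N -orderH -edgesH.
  by apply: fourier_norm1_cone_ge; rewrite ?orderH ?edgesH.
split => //.
(* The 2-norm of the cone is [Q], so the second bound is the first divided by [Q]. *)
rewrite /FRmin norm2_cone // orderH edgesH -/Q invfM mulrA -mulrDl.
by rewrite ler_wpM2r // invr_ge0 sqrtr_ge0.
Qed.
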